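(* Let $\mathbb K$ be a commutative field and $\mathcal X$ a finite set of free non-commuting variables. The map $$A\longmapsto \|A\|=\dim(\overline A+\mathbb K)-1$$ defines a norm on the special group of rational units $S\mathbb K\langle\!\langle\mathcal X\rangle\!\rangle_{rat}^*$. Here $\mathbb K$ is identified with the subspace of constant series, and $\overline A$ denotes the recursive closure of $A$.
   Context: $\mathcal X^*$ is the free monoid on $\mathcal X$. $\mathbb K\langle\!\langle\mathcal X\rangle\!\rangle$ is the algebra of non-commutative formal power series $A=\sum_{\mathbf X\in\mathcal X^*}(A,\mathbf X)\mathbf X$ with the convolution (Cauchy) product. The augmentation $\epsilon(A)=(A,\mathbf 1)$ is the constant coefficient, and $A$ is invertible iff $\epsilon(A)\neq0$. A subalgebra (with unit) is rationally closed if it intersects the unit group $\mathbb K\langle\!\langle\mathcal X\rangle\!\rangle^*$ in a subgroup. $\mathbb K\langle\!\langle\mathcal X\rangle\!\rangle_{rat}$ is the smallest rationally closed subalgebra containing $\mathcal X$, and its elements are called rational. $S\mathbb K\langle\!\langle\mathcal X\rangle\!\rangle_{rat}^*$ is the multiplicative group of rational series $A$ with $\epsilon(A)=1$. For $\mathbf T\in\mathcal X^*$ the shift map is $\rho(\mathbf T)A=\sum_{\mathbf X\in\mathcal X^*}(A,\mathbf X\mathbf T)\mathbf X$. The recursive closure $\overline A$ is the linear span of $\{\rho(\mathbf T)A : \mathbf T\in\mathcal X^*\}$. By a theorem of Schützenberger, $\overline A$ is finite-dimensional iff $A$ is rational. A norm on a group $\Gamma$ with identity $e$ is a map $\|\cdot\|:\Gamma\to\mathbb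 R_{\ge0}$ such that $\|e\|=0$, $\|\gamma\|>0$ for $\gamma\ne e$, $\|\gamma\delta\|\le\|\gamma\|+\|\delta\|$, and $\|\gamma^{-1}\|=\|\gamma\|$ for all $\gamma,\delta\in\Gamma$. *)

(* Defs.v *)
From HB Require Import structures.
From mathcomp Require Import all_boot all_order all_algebra all_fingroup.
From mathcomp Require Import boolp classical_sets functions reals.
Set Implicit Arguments.
Unset Strict Implicit.
Unset Printing Implicit Defensive.
Import Order.TTheory GRing.Theory Num.Theory.
Local Open Scope classical_set_scope.
Local Open Scope ring_scope.

(* A series is its coefficient function on words: A w stands for (A, w).      *)
(* The alias carries the pointwise K-module structure of functions, but its   *)
(* ring structure below is the Cauchy product, not the pointwise one.         *)
Definition series (K : fieldType) (X : finType) : Type := seq X -> K^o.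

HB.instance Definition _ (K : fieldType) (X : finType) :=
  GRing.Lmodule.copy (series K X) (seq X -> K^o).

Section SeriesRing.
Variables (K : fieldType) (X : finType).
Implicit Types (A B C N : series K X) (w : seq X) (x : X).

Definition eps A : K := A [::].

Definition one_series : series K X := fun w => (w == [::])%:R.

Definition mul_series A B : series K X :=
  fun w => \sum_(i < (size w).+1) (A (take i w) : K) * B (drop i w).

Let addE A B w : (A + B) w = A w + B w. Proof. by []. Qed.
Let scaleE (a : K) A w : (a *: A) w = a * A w. Proof. by []. Qed.
Let oppE A w : (- A) w = - A w. Proof. by []. Qed.

Let lder x A : series K X := fun w => A (x :: w).

Let mul_nil A B : mul_series A B [::] = A [::] * B [::].
Proof. by rewrite /mul_series big_ord_recl big_ord0 addr0. Qed.

Let mul_cons A B x w :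
  mul_series A B (x :: w) = A [::] * B (x :: w) + mul_series (lder x A) B w.
Proof. by rewrite /mul_series big_ord_recl. Qed.

Let mulDl : left_distributive mul_series +%R.
Proof.
move=> A B C; apply/funext => w; rewrite addE /mul_series -big_split.
by apply: eq_bigr => i _; rewrite addE mulrDl.
Qed.

Let mulDr : right_distributive mul_series +%R.
Proof.
move=> A B C; apply/funext => w; rewrite addE /mul_series -big_split.
by apply: eq_bigr => i _; rewrite addE mulrDr.
Qed.

Let scaleAl (a : K) A B : a *: mul_series A B = mul_series (a *: A) B.
Proof.
apply/funext => w; rewrite scaleE /mul_series mulr_sumr.
by apply: eq_bigr => i _; rewrite scaleE mulrA.
Qed.

Let lderM x A B :
  lder x (mul_series A B) = A [::] *: lder x B + mul_series (lder x A) B.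
Proof. by apply/funext => w; rewrite addE scaleE /lder mul_cons. Qed.

Let mulA : associative mul_series.
Proof.
move=> A B C; apply/funext => w; elim: w A B C => [|x w IHw] A B C.
  by rewrite !mul_nil mulrA.
rewrite !mul_cons lderM mulDl addE -scaleAl scaleE mul_nil IHw mulrDr mulrA.
by rewrite addrA.
Qed.

Let mul0 A : mul_series 0 A = 0.
Proof. by apply: (addrI (mul_series 0 A)); rewrite -mulDl !addr0. Qed.

Let lder1 x : lder x one_series = 0.
Proof. by apply/funext. Qed.

Let mul1 : left_id one_series mul_series.
Proof.
move=> A; apply/funext => -[|x w]; rewrite ?mul_nil ?mul_cons ?lder1 ?mul0 mul1r//.
by rewrite addr0.
Qed.

Let mulr1 : right_id one_series mul_series.
Proof.
move=> A; apply/funext => w; elim: w A => [|x w IHw] A.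
  by rewrite mul_nil mulr1.
by rewrite mul_cons IHw mulr0 add0r.
Qed.

Let one_neq0 : one_series != 0.
Proof.
by apply/eqP => /(congr1 (fun A => A [::])) /eqP; rewrite /one_series oner_eq0.
Qed.

HB.instance Definition _ := GRing.Zmodule_isNzRing.Build (series K X)
  mulA mul1 mulr1 mulDl mulDr one_neq0.

HB.instance Definition _ := GRing.Lmodule_isLalgebra.Build K (series K X) scaleAl.

Let scaleAr (a : K) A B : a *: (A * B) = A * (a *: B).
Proof.
apply/funext => w; rewrite scaleE -![(_ * _ : series K X) w]/(mul_series _ _ w).
rewrite /mul_series mulr_sumr.
by apply: eq_bigr => i _; rewrite scaleE mulrCA.
Qed.

HB.instance Definition _ := GRing.Lalgebra_isAlgebra.Build K (series K X) scaleAr.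

Lemma epsM A B : eps (A * B) = eps A * eps B.
Proof. exact: mul_nil. Qed.

Lemma eps1 : eps (1 : series K X) = 1.
Proof. by []. Qed.

(* The sum of all powers N^n, for eps N = 0: only those with n <= |w|         *)
(* contribute to the coefficient of w.                                        *)
Definition star_series N : series K X :=
  fun w => \sum_(n < (size w).+1) (N ^+ n) w.

(* With a = eps A nonzero, A = a(1 - N) where N = 1 - a^-1 A has eps N = 0.   *)
Definition inv_series A : series K X :=
  if eps A == 0 then A else
  (eps A)^-1 *: star_series (1 - (eps A)^-1 *: A).

Let geom N m : series K X := \sum_(n < m) N ^+ n.

Let sumE (I : finType) (F : I -> series K X) w : (\sum_i F i) w = \sum_i F i w.
Proof.
by apply: (big_ind2 (fun (A : series K X) (a : K) => A w = a)) => // A a B b <- <-.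
Qed.

Let powlt N n w : eps N = 0 -> (size w < n)%N -> (N ^+ n) w = 0.
Proof.
move=> N0; elim: n w => [|n IHn] w //; rewrite ltnS exprSr => wn.
rewrite [LHS]big1 // => i _.
have [iw|wi] := ltnP i (size w).
  by rewrite IHn ?mul0r// size_take iw (leq_trans iw).
by rewrite drop_oversize// [N [::]]N0 mulr0.
Qed.

Let geomS N m w : eps N = 0 -> (size w < m)%N ->
  geom N m w = \sum_(n < (size w).+1) (N ^+ n) w.
Proof.
move=> N0; elim: m => // m IHm; rewrite ltnS leq_eqVlt => /orP[/eqP <-|wm].
  by rewrite /geom sumE.
by rewrite /geom big_ord_recr /= addE powlt// addr0 -/(geom N m) IHm.
Qed.

Let mul_trunc_r A B B' m w : (size w < m)%N ->
  (forall v, (size v < m)%N -> B v = B' v) -> (A * B) w = (A * B') w.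
Proof.
move=> wm BB'; apply: eq_bigr => i _; congr (_ * _); apply: BB'.
by rewrite size_drop (leq_ltn_trans (leq_subr _ _)).
Qed.

Let mul_trunc_l A B B' m w : (size w < m)%N ->
  (forall v, (size v < m)%N -> B v = B' v) -> (B * A) w = (B' * A) w.
Proof.
move=> wm BB'; apply: eq_bigr => i _; congr (_ * _); apply: BB'.
by rewrite (leq_ltn_trans _ wm)// size_take; case: ltnP => // /ltnW.
Qed.

Let G A := star_series (1 - (eps A)^-1 *: A).

Let epsN A : eps A != 0 -> eps (1 - (eps A)^-1 *: A) = 0.
Proof.
by move=> A0; rewrite /eps addE oppE scaleE mulVf// [X in X + _]eps1 subrr.
Qed.

Let geomP A m : (1 - (1 - A)) * geom (1 - A) m = 1 - (1 - A) ^+ m /\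
  geom (1 - A) m * (1 - (1 - A)) = 1 - (1 - A) ^+ m.
Proof.
have E : (1 - (1 - A)) * geom (1 - A) m = 1 - (1 - A) ^+ m.
  by rewrite -[LHS]opprK -mulNr opprB -subrX1 opprB.
split=> //; rewrite -E; apply: commr_sym; apply: commr_sum => i _.
by apply: commrX; apply: commr_sym; apply: commrB; [exact: commr1|].
Qed.

Let mulG A : eps A != 0 -> ((eps A)^-1 *: A) * G A = 1 /\ G A * ((eps A)^-1 *: A) = 1.
Proof.
move=> A0; set A' := _ *: A.
have GE w m : (size w < m)%N -> G A w = geom (1 - A') m w.
  by move=> wm; rewrite geomS// epsN.
have AE : A' = 1 - (1 - A') by rewrite opprB addrC subrK.
split; apply/funext => w.
  rewrite (@mul_trunc_r _ _ (geom (1 - A') (size w).+1) (size w).+1) //.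
    rewrite {1}AE (geomP A' _).1 addE oppE powlt ?subr0//.
    exact: epsN.
  move=> v vw; exact: GE.
rewrite (@mul_trunc_l _ _ (geom (1 - A') (size w).+1) (size w).+1) //.
  rewrite {2}AE (geomP A' _).2 addE oppE powlt ?subr0//.
  exact: epsN.
move=> v vw; exact: GE.
Qed.

Let unit_series : {pred series K X} := fun A => eps A != 0.

Let invE A : eps A != 0 -> inv_series A = (eps A)^-1 *: G A.
Proof. by rewrite /inv_series => /negPf ->. Qed.

Let mulVs : {in unit_series, left_inverse 1 inv_series *%R}.
Proof. by move=> A A0; rewrite invE// -scalerAl scalerAr (mulG A0).2. Qed.

Let mulsV : {in unit_series, right_inverse 1 inv_series *%R}.
Proof. by move=> A A0; rewrite invE// -scalerAr scalerAl (mulG A0).1. Qed.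

Let unitP A B : B * A = 1 /\ A * B = 1 -> unit_series A.
Proof.
move=> [_ /(congr1 eps)]; rewrite epsM eps1 => AB; apply/eqP => A0.
by move/eqP: AB; rewrite A0 mul0r eq_sym oner_eq0.
Qed.

Let inv_out : {in [predC unit_series], inv_series =1 id}.
Proof. by move=> A; rewrite /inv_series inE negbK => ->. Qed.

HB.instance Definition _ := GRing.NzRing_hasMulInverse.Build (series K X)
  mulVs mulsV unitP inv_out.

Lemma unit_seriesE A : (A \is a GRing.unit) = (eps A != 0).
Proof. by []. Qed.

End SeriesRing.

Section Rational.
Variables (K : fieldType) (X : finType).
Implicit Types (A B : series K X).

Definition letter (x : X) : series K X := fun w => (w == [:: x])%:R.

(* Subsets are boolean predicates, which classically is no restriction.       *)
(* A subalgebra already contains 1 and is stable under products, so meeting   *)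
(* the unit group in a subgroup amounts to stability under inverses of units. *)
Definition rationally_closed (S : {pred series K X}) : Prop :=
  GRing.subalg_closed S /\ {in S, forall A, A \is a GRing.unit -> A^-1 \in S}.

Definition rational : {pred series K X} := fun A =>
  `[< forall S : {pred series K X}, rationally_closed S ->
        (forall x, letter x \in S) -> A \in S >].

Lemma rational_closed : rationally_closed rational.
Proof.
split; [split|].
- by apply/asboolP => S [[]].
- move=> a A B /asboolP hA /asboolP hB; apply/asboolP => S cS lS.
  by case: (cS) => -[_ linS _] _; apply: linS; [apply: hA|apply: hB].
- move=> A B /asboolP hA /asboolP hB; apply/asboolP => S cS lS.
  by case: (cS) => -[_ _ mulS] _; apply: mulS; [apply: hA|apply: hB].
- move=> A /asboolP hA uA; apply/asboolP => S cS lS.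
  by apply: cS.2 => //; apply: hA.
Qed.

Record srat := SRat {
  srat_val :> series K X;
  srat_valP : (srat_val \in rational) && (eps srat_val == 1)
}.

HB.instance Definition _ := [isSub for srat_val].
HB.instance Definition _ := [Choice of srat by <:].

Lemma srat_one_proof : ((1 : series K X) \in rational) && (eps (1 : series K X) == 1).
Proof. by rewrite eps1 eqxx andbT; case: rational_closed => -[]. Qed.

Lemma srat_mul_proof (A B : srat) :
  (srat_val A * srat_val B \in rational) && (eps (srat_val A * srat_val B) == 1).
Proof.
case: A B => [A /andP[rA /eqP eA]] [B /andP[rB /eqP eB]] /=.
rewrite epsM eA eB mulr1 eqxx andbT.
by case: rational_closed => -[_ _ mulS] _; apply: mulS.
Qed.

Lemma srat_unit (A : srat) : (A : series K X) \is a GRing.unit.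
Proof. by rewrite unit_seriesE; case/andP: (srat_valP A) => _ /eqP ->; rewrite oner_eq0. Qed.

Lemma srat_inv_proof (A : srat) :
  ((srat_val A)^-1 \in rational) && (eps (srat_val A)^-1 == 1).
Proof.
have uA := srat_unit A; case/andP: (srat_valP A) => rA /eqP eA.
apply/andP; split; first exact: rational_closed.2.
have := congr1 (@eps K X) (mulVr uA).
by rewrite epsM eA mulr1 eps1 => ->.
Qed.

Definition srat_one := SRat srat_one_proof.
Definition srat_mul (A B : srat) := SRat (srat_mul_proof A B).
Definition srat_inv (A : srat) := SRat (srat_inv_proof A).

Let srat_mulA : associative srat_mul.
Proof. by move=> A B C; apply: val_inj; rewrite /= mulrA. Qed.
Let srat_mul1 : left_id srat_one srat_mul.
Proof. by move=> A; apply: val_inj; rewrite /= mul1r. Qed.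
Let srat_mulr1 : right_id srat_one srat_mul.
Proof. by move=> A; apply: val_inj; rewrite /= mulr1. Qed.
Let srat_mulV : left_inverse srat_one srat_inv srat_mul.
Proof. by move=> A; apply: val_inj; rewrite /= mulVr// srat_unit. Qed.
Let srat_mulVr : right_inverse srat_one srat_inv srat_mul.
Proof. by move=> A; apply: val_inj; rewrite /= mulrV// srat_unit. Qed.

HB.instance Definition _ := isGroup.Build srat
  srat_mulA srat_mul1 srat_mulr1 srat_mulV srat_mulVr.

End Rational.

Section Dimension.
Variables (K : fieldType) (V : lmodType K).
Implicit Types (E W : set V).

Definition lspan E : set V :=
  [set v | exists (n : nat) (c : 'I_n -> K) (e : 'I_n -> V),
     (forall i, E (e i)) /\ v = \sum_i c i *: e i].

Definition sum_subspace W1 W2 : set V := [set u + v | u in W1 & v in W2].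

Definition is_basis W n (e : 'I_n -> V) : Prop :=
  (forall c : 'I_n -> K, \sum_i c i *: e i = 0 -> forall i, c i = 0) /\
  lspan (range e) = W.

Definition finite_dim W : Prop := exists n (e : 'I_n -> V), is_basis W e.

(* Meaningful only when W is a finite-dimensional subspace (0 otherwise). *)
Definition subspace_dim W : nat := xget 0%N [set n | exists e : 'I_n -> V, is_basis W e].

End Dimension.

Section Closure.
Variables (K : fieldType) (X : finType).

Definition shift (T : seq X) (A : series K X) : series K X := fun w => A (w ++ T).

Definition rec_closure (A : series K X) : set (series K X) :=
  lspan (range (fun T => shift T A)).

Definition constants : set (series K X) := range (fun c : K => c%:A).

End Closure.
Arguments constants {K X}.

Definition is_group_norm (R : realType) (G : groupType) (N : G -> R) : Prop :=
  [/\ forall g, 0 <= N g,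
      N 1%g = 0,
      forall g, g <> 1%g -> 0 < N g,
      forall g h, N (g * h)%g <= N g + N h &
      forall g, N (g^-1)%g = N g].

(* The subtraction takes place in R, so it is not truncated. *)
Definition rat_norm (R : realType) (K : fieldType) (X : finType)
    (A : srat K X) : R :=
  (subspace_dim (sum_subspace (rec_closure A) constants))%:R - 1.

(* Main.v *)
Require Import Defs.
From HB Require Import structures.
From mathcomp Require Import all_boot all_order all_algebra all_fingroup.
From mathcomp Require Import boolp classical_sets functions reals.

Set Implicit Arguments.
Unset Strict Implicit.
Unset Printing Implicit Defensive.
Import Order.TTheory GRing.Theory Num.Theory.
Local Open Scope classical_set_scope.
Local Open Scope ring_scope.

(* The space W(A) = closure(A) + K is the least shift-stable subspace containing
   A and 1.  For a letter x the shift obeys the Leibniz-like rule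
   rho(x)(AB) = A rho(x)B + eps(B) rho(x)A, which makes W(A) + A W(B) stable;
   it contains 1 and AB, hence W(AB), and its two summands share A <> 0, so
   dim W(AB) <= dim W(A) + dim W(B) - 1.  The same rule makes A^-1 W(A) stable,
   and it contains A^-1 = A^-1 1 and 1 = A^-1 A, so dim W(A^-1) <= dim W(A).
   Finite dimension follows because the series lying in some finite-dimensional
   shift-stable subspace form a rationally closed subalgebra. *)

(** * Subspaces and spans in a vector space of arbitrary dimension *)

Section LinearAlgebra.
Variables (K : fieldType) (V : lmodType K).
Implicit Types (U W : set V) (u v w : V).

Definition subspace W : Prop :=
  W 0 /\ forall (a : K) u v, W u -> W v -> W (a *: u + v).

Definition fspan n (e : 'I_n -> V) : set V :=
  [set v | exists c : 'I_n -> K, v = \sum_i c i *: e i].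

Definition free_family n (e : 'I_n -> V) : Prop :=
  forall c : 'I_n -> K, \sum_i c i *: e i = 0 -> forall i, c i = 0.

(** Mere inclusion: the family may leave [W], so the property passes to every smaller set, and
    dimension bounds follow from inclusions alone. *)
Definition spanned_by n W : Prop := exists e : 'I_n -> V, W `<=` fspan e.

Definition fcons n v (e : 'I_n -> V) : 'I_n.+1 -> V :=
  fun i => oapp e v (unlift ord0 i).

(** Generic in [T], so that scalars and vectors are concatenated by the same map. *)
Definition fcat T m n (e : 'I_m -> T) (f : 'I_n -> T) : 'I_(m + n) -> T :=
  fun i => match fintype.split i with inl j => e j | inr j => f j end.

Lemma fcatl T m n (e : 'I_m -> T) (f : 'I_n -> T) i : fcat e f (lshift n i) = e i.
Proof. by rewrite /fcat -[lshift n i]/(unsplit (inl i)) unsplitK. Qed.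

Lemma fcatr T m n (e : 'I_m -> T) (f : 'I_n -> T) i : fcat e f (rshift m i) = f i.
Proof. by rewrite /fcat -[rshift m i]/(unsplit (inr i)) unsplitK. Qed.

Lemma sum_fcons n (c : 'I_n.+1 -> K) v (e : 'I_n -> V) :
  \sum_i c i *: fcons v e i = c ord0 *: v + \sum_i c (lift ord0 i) *: e i.
Proof.
rewrite big_ord_recl /fcons unlift_none; congr (_ + _).
by apply: eq_bigr => i _; rewrite liftK.
Qed.

Lemma sum_fcat m n (c : 'I_m -> K) (d : 'I_n -> K) (e : 'I_m -> V) (f : 'I_n -> V) :
  \sum_i fcat c d i *: fcat e f i = \sum_i c i *: e i + \sum_i d i *: f i.
Proof.
rewrite big_split_ord; congr (_ + _); apply: eq_bigr => i _.
  by rewrite !fcatl.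
by rewrite !fcatr.
Qed.

Lemma subspaceD W u v : subspace W -> W u -> W v -> W (u + v).
Proof. by move=> [_ WP] Wu Wv; rewrite -[u]scale1r; apply: WP. Qed.

Lemma subspaceZ W (a : K) v : subspace W -> W v -> W (a *: v).
Proof. by move=> [W0 WP] Wv; rewrite -[_ *: _]addr0; apply: WP. Qed.

Lemma subspaceB W u v : subspace W -> W u -> W v -> W (u - v).
Proof.
by move=> sW Wu Wv; apply: subspaceD => //; rewrite -scaleN1r; apply: subspaceZ.
Qed.

Lemma subspace_sum W n (c : 'I_n -> K) (e : 'I_n -> V) :
  subspace W -> (forall i, W (e i)) -> W (\sum_i c i *: e i).
Proof.
move=> sW We; elim/big_ind: _ => [|u v|i _]; first by case: sW.
  exact: subspaceD.
exact: subspaceZ.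
Qed.

Lemma subspace_fspan n (e : 'I_n -> V) : subspace (fspan e).
Proof.
split=> [|a _ _ [c ->] [d ->]].
  by exists (fun=> 0); rewrite big1 // => i _; rewrite scale0r.
exists (fun i => a * c i + d i); rewrite scaler_sumr -big_split.
by apply: eq_bigr => i _; rewrite scalerDl scalerA.
Qed.

Lemma fspan_mem n (e : 'I_n -> V) i : fspan e (e i).
Proof.
exists (fun j => (j == i)%:R); rewrite (bigD1 i) //= eqxx scale1r big1 ?addr0 //.
by move=> j /negPf ->; rewrite scale0r.
Qed.

Lemma subspace_lspan (E : set V) : subspace (lspan E).
Proof.
split=> [|a _ _ [m [c [e [Ee ->]]]] [n [d [f [Ef ->]]]]].
  by exists 0%N, (fun=> 0), (fun=> 0); split=> [[]|] //; rewrite big_ord0.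
exists (m + n)%N, (fcat (fun i => a * c i) d), (fcat e f); split=> [i|].
  by rewrite /fcat; case: (fintype.split i).
rewrite sum_fcat scaler_sumr; congr (_ + _).
by apply: eq_bigr => i _; rewrite scalerA.
Qed.

Lemma lspan_mem (E : set V) v : E v -> lspan E v.
Proof.
by move=> Ev; exists 1%N, (fun=> 1), (fun=> v); split=> //; rewrite big_ord1 scale1r.
Qed.

Lemma lspan_min (E W : set V) : subspace W -> E `<=` W -> lspan E `<=` W.
Proof.
by move=> sW EW _ [n [c [e [Ee ->]]]]; apply: subspace_sum => // i; apply: EW.
Qed.

Lemma lspan_range n (e : 'I_n -> V) : lspan (range e) = fspan e.
Proof.
apply/seteqP; split.
  apply: lspan_min; first exact: subspace_fspan.
  by move=> _ [i _ <-]; apply: fspan_mem.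
move=> _ [c ->]; apply: subspace_sum; first exact: subspace_lspan.
by move=> i; apply: lspan_mem; exists i.
Qed.

Lemma subspace_sum_subspace U W :
  subspace U -> subspace W -> subspace (sum_subspace U W).
Proof.
move=> sU sW; split=> [|a _ _ [u Uu [w Ww <-]] [u' Uu' [w' Ww' <-]]].
  by exists 0; [case: sU|exists 0; [case: sW|rewrite addr0]].
exists (a *: u + u'); first exact: sU.2.
by exists (a *: w + w'); [exact: sW.2|rewrite scalerDr addrACA].
Qed.

Lemma sum_subspacel U W u : subspace W -> U u -> sum_subspace U W u.
Proof. by move=> [W0 _] Uu; exists u => //; exists 0; rewrite ?addr0. Qed.

Lemma sum_subspacer U W w : subspace U -> W w -> sum_subspace U W w.
Proof. by move=> [U0 _] Ww; exists 0 => //; exists w; rewrite ?add0r. Qed.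

Lemma sum_subspace_min (E U W : set V) :
  subspace W -> E `<=` W -> U `<=` W -> sum_subspace E U `<=` W.
Proof.
by move=> sW EW UW _ [u /EW Wu [v /UW Wv <-]]; apply: subspaceD.
Qed.

Lemma spanned_byD m n U W :
  spanned_by m U -> spanned_by n W -> spanned_by (m + n) (sum_subspace U W).
Proof.
move=> [e Ue] [f Wf]; exists (fcat e f) => _ [_ /Ue[c ->] [_ /Wf[d ->] <-]].
by exists (fcat c d); rewrite sum_fcat.
Qed.

(** * Dimension: bases, bounds and sums of subspaces *)

(** Let [M] hold the coordinates of the [e i] over [f]. If [n < m], its left kernel has a nonzero
    row, which is a nontrivial relation among the [e i]. *)
Lemma free_leq m n (e : 'I_m -> V) (f : 'I_n -> V) :
  free_family e -> (forall i, fspan f (e i)) -> (m <= n)%N.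
Proof.
move=> fe /choice[c ce]; rewrite leqNgt; apply/negP => ltnm.
pose M := \matrix_(i, j) c i j; pose u := nz_row (kermx M).
have uM : u *m M = 0 by apply/sub_kermxP; exact: nz_row_sub.
suff u0 : u = 0.
  move/eqP: u0; rewrite nz_row_eq0 -mxrank_eq0 mxrank_ker subn_eq0 leqNgt.
  by rewrite (leq_ltn_trans (rank_leq_col M)).
apply/rowP => i; rewrite mxE; apply: (fe (u ord0)).
under eq_bigr => k _ do rewrite ce scaler_sumr.
rewrite exchange_big big1 // => j _.
under eq_bigr => k _ do rewrite scalerA.
rewrite -scaler_suml; have /rowP/(_ j) := uM; rewrite !mxE.
by under eq_bigr => k _ do rewrite mxE; move=> ->; rewrite scale0r.
Qed.

(** Free families in [W] have at most [n] members, so one of maximal size exists. It spans [W],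
    since any vector outside its span could be added to it. *)
Lemma basis_exists n W : subspace W -> spanned_by n W ->
  exists m (e : 'I_m -> V), (m <= n)%N /\ is_basis W e.
Proof.
move=> sW [f Wf].
pose P m := `[< exists e : 'I_m -> V, free_family e /\ forall i, W (e i) >].
have P0 : exists m, P m by exists 0%N; apply/asboolP; exists (fun=> 0); split=> [c _|] [].
have Pn m : P m -> (m <= n)%N.
  by move=> /asboolP[e [fe We]]; apply: free_leq fe _ => i; apply/Wf.
case: (ex_maxnP P0 Pn) => m Pm maxm; exists m.
case/asboolP: (Pm) => e [fe We]; exists e; split; first exact: Pn.
split=> //; rewrite lspan_range; apply/seteqP; split=> [_ [c ->]|w Ww].
  exact: subspace_sum.
apply: contrapT => Nw; suff /maxm : P m.+1 by rewrite ltnn.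
apply/asboolP; exists (fcons w e); split; last first.
  by move=> i; rewrite /fcons; case: unlift.
move=> c; rewrite sum_fcons; have [c0|c0] := eqVneq (c ord0) 0.
  rewrite c0 scale0r add0r => /fe ce i.
  by case: (unliftP ord0 i) => [j|] ->.
move=> /eqP; rewrite addr_eq0 => /eqP cw; case: Nw.
rewrite -[w]scale1r -(mulVf c0) -scalerA cw.
apply: subspaceZ; first exact: subspace_fspan.
rewrite -scaleN1r; apply: subspaceZ; first exact: subspace_fspan.
by exists (fun i => c (lift ord0 i)).
Qed.

Lemma spanned_by_finite_dim n W : subspace W -> spanned_by n W -> finite_dim W.
Proof. by move=> sW /(basis_exists sW)[m [e [_ be]]]; exists m, e. Qed.

(** Two bases bound each other's length by [free_leq], so the value picked by [xget] is the length
    of any basis. *)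
Lemma subspace_dimE n (e : 'I_n -> V) W : is_basis W e -> subspace_dim W = n.
Proof.
move=> be; rewrite /subspace_dim; case: xgetP => [m _ [f bf]|/(_ n)]; last first.
  by case; exists e.
case: be bf => fe We [ff Wf]; rewrite !lspan_range in We Wf.
apply/eqP; rewrite eqn_leq; apply/andP; split.
  by apply: (free_leq (f := e) ff) => i; rewrite We -Wf; apply: fspan_mem.
by apply: (free_leq (f := f) fe) => i; rewrite Wf -We; apply: fspan_mem.
Qed.

Lemma subspace_dim_leq n W : subspace W -> spanned_by n W -> (subspace_dim W <= n)%N.
Proof. by move=> sW /(basis_exists sW)[m [e [lemn /subspace_dimE ->]]]. Qed.

Lemma spanned_by_dim W : finite_dim W -> spanned_by (subspace_dim W) W.
Proof.
move=> [n [e be]]; rewrite (subspace_dimE be); exists e.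
by case: be => _ <-; rewrite lspan_range.
Qed.

Lemma free_leq_dim n (e : 'I_n -> V) W : finite_dim W -> free_family e ->
  (forall i, W (e i)) -> (n <= subspace_dim W)%N.
Proof. by move=> /spanned_by_dim[f Wf] fe We; apply: free_leq fe _ => i; apply/Wf. Qed.

Lemma free_fcons0 v (e : 'I_0 -> V) : v <> 0 -> free_family (fcons v e).
Proof.
move=> /eqP v0 c; rewrite sum_fcons big_ord0 addr0 => /eqP.
by rewrite scaler_eq0 (negPf v0) orbF => /eqP c0 i; rewrite ord1.
Qed.

(* The common vector v can replace one of the vectors spanning W. *)
Lemma sum_subspace_dim_ltn U W v : finite_dim U -> finite_dim W ->
  subspace U -> U v -> W v -> v <> 0 ->
  exists2 n, (n < subspace_dim U + subspace_dim W)%N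
           & spanned_by n (sum_subspace U W).
Proof.
move=> /spanned_by_dim genU /spanned_by_dim[].
case: (subspace_dim W) => [|n] f Wf sU Uv Wv v0.
  by case: v0; have [c ->] := Wf _ Wv; rewrite big_ord0.
have [c vE] := Wf _ Wv.
(* As [v] is nonzero, some [f k] occurs in it; this is the vector that [v] replaces. *)
have [k ck] : exists k, c k <> 0.
  apply: contrapT => Nc; apply: v0; rewrite vE big1 // => i _.
  by have [->|/eqP ci] := eqVneq (c i) 0; [rewrite scale0r|case: Nc; exists i].
exists (subspace_dim U + n)%N; first by rewrite addnS.
have {genU}: spanned_by (subspace_dim U + n)
    (sum_subspace U (fspan (fun i => f (lift k i)))).
  by apply: spanned_byD => //; exists (fun i => f (lift k i)).
move=> [e eP]; exists e => _ [u Uu [_ /Wf[d ->] <-]]; apply: eP.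
have sum_liftE (g : 'I_n.+1 -> K) :
    \sum_i g i *: f i = g k *: f k + \sum_i g (lift k i) *: f (lift k i).
  exact: bigD1_ord.
(* The multiple [d k / c k] of [v] has the same coefficient at [f k] as the vector of [W]. Moved
   into [U], it leaves a combination of the other [f i]. *)
exists ((d k / c k) *: v + u); first exact: sU.2.
exists (\sum_i (d (lift k i) - d k / c k * c (lift k i)) *: f (lift k i)).
  by exists (fun i => d (lift k i) - d k / c k * c (lift k i)).
under eq_bigr => i _ do rewrite scalerBl -scalerA.
rewrite sumrB -scaler_sumr (sum_liftE d) vE (sum_liftE c) scalerDr scalerA.
rewrite divfK; last exact/eqP.
rewrite [_ + u]addrC -addrA; congr (_ + _).
by rewrite addrACA subrr addr0.
Qed.

End LinearAlgebra.

(** * Shift-stable subspaces and the product rule for shifts *)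

Section ShiftStable.
Variables (K : fieldType) (X : finType).
Implicit Types (A B : series K X) (U W : set (series K X)) (x : X).

Lemma shift_is_linear (T : seq X) : linear (@shift K X T).
Proof. by []. Qed.
HB.instance Definition _ (T : seq X) :=
  GRing.isLinear.Build K (series K X) (series K X) *:%R (@shift K X T)
    (shift_is_linear T).

(** One-letter shifts suffice: they generate all shifts, by [shift_cons]. *)
Definition shift_stable W : Prop :=
  subspace W /\ forall x A, W A -> W (shift [:: x] A).

Lemma shift_cons x T A : shift (x :: T) A = shift [:: x] (shift T A).
Proof. by apply/funext => w; rewrite /shift -catA. Qed.

(** A cut of the word [w ++ [:: x]] either falls within [w] or at its end, leaving [x] to the right
    factor, or comes after [x], leaving the right factor only the empty word and hence [eps B]. *)
Lemma shiftM x A B :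
  shift [:: x] (A * B) = A * shift [:: x] B + eps B *: shift [:: x] A.
Proof.
apply/funext => w.
rewrite -[LHS]/(\sum_(i < (size (w ++ [:: x])).+1)
  ((A (take i (w ++ [:: x])) : K) * B (drop i (w ++ [:: x])))).
rewrite size_cat addn1 big_ord_recr /=; congr (_ + _).
  apply: eq_bigr => i _; have le_iw : (i <= size w)%N by rewrite -ltnS.
  rewrite takel_cat // drop_cat.
  (* The cut just before [x] lands in the second branch of [drop_cat]; both sides then leave
     [[:: x]]. *)
  case: ltnP => // wi; have -> : (i : nat) = size w.
    by apply/eqP; rewrite eqn_leq le_iw.
  by rewrite subnn drop0 drop_size.
by rewrite take_oversize ?drop_oversize ?size_cat ?addn1 // mulrC.
Qed.

Lemma shift1 x : shift [:: x] (1 : series K X) = 0.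
Proof. by apply/funext => -[]. Qed.

(** The product rule applied to [A * A^-1 = 1], whose shift vanishes. *)
Lemma shiftV x A : A \is a GRing.unit ->
  shift [:: x] A^-1 = - (eps A^-1 *: (A^-1 * shift [:: x] A)).
Proof.
move=> uA; apply: (mulrI uA); rewrite mulrN -scalerAr mulrA mulrV // mul1r.
by apply/eqP; rewrite -addr_eq0 -shiftM mulrV // shift1.
Qed.

Lemma shift_stable_rec_closure A : shift_stable (rec_closure A).
Proof.
split=> [|x _ [n [c [e [Ee ->]]]]]; first exact: subspace_lspan.
rewrite linear_sum; under eq_bigr => i _ do rewrite linearZ.
apply: subspace_sum => [|i]; first exact: subspace_lspan.
by apply: lspan_mem; have [T _ <-] := Ee i; exists (x :: T) => //; rewrite shift_cons.
Qed.

Lemma rec_closure_mem A : rec_closure A A.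
Proof.
apply: lspan_mem; exists [::] => //.
by apply/funext => w; rewrite /shift cats0.
Qed.

Lemma rec_closure_min A W : shift_stable W -> W A -> rec_closure A `<=` W.
Proof.
move=> [sW stW] WA; apply: lspan_min => // _ [T _ <-].
elim: T => [|x T IHT]; last by rewrite shift_cons; apply: stW.
by rewrite (_ : shift [::] A = A) //; apply/funext => w; rewrite /shift cats0.
Qed.

Lemma constants1 : constants (1 : series K X).
Proof. by exists 1; rewrite ?scale1r. Qed.

Lemma constants_min W : subspace W -> W 1 -> constants `<=` W.
Proof. by move=> sW W1 _ [c _ <-]; apply: subspaceZ. Qed.

Lemma shift_stable_constants : shift_stable constants.
Proof.
split; [split|].
- by exists 0; rewrite ?scale0r.
- move=> a _ _ [c _ <-] [d _ <-]; exists (a * c + d) => //.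
  by rewrite scalerDl scalerA.
- by move=> x _ [c _ <-]; exists 0; rewrite // linearZ /= shift1 scaler0 scale0r.
Qed.

Lemma constants_spanned_by1 : spanned_by 1 (constants : set (series K X)).
Proof. by exists (fun=> 1) => _ [c _ <-]; exists (fun=> c); rewrite big_ord1. Qed.

Lemma shift_stableD U W :
  shift_stable U -> shift_stable W -> shift_stable (sum_subspace U W).
Proof.
move=> [sU stU] [sW stW]; split=> [|x _ [A UA [B WB <-]]].
  exact: subspace_sum_subspace.
exists (shift [:: x] A); first exact: stU.
by exists (shift [:: x] B); [exact: stW|rewrite linearD].
Qed.

Lemma subspace_mull A W : subspace W -> subspace ( *%R A @` W).
Proof.
move=> [W0 WP]; split=> [|a _ _ [B WB <-] [C WC <-]].
  by exists 0; rewrite ?mulr0.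
by exists (a *: B + C); [exact: WP|rewrite mulrDr scalerAr].
Qed.

Lemma spanned_by_mull n A W : spanned_by n W -> spanned_by n ( *%R A @` W).
Proof.
move=> [e We]; exists (fun i => A * e i) => _ [_ /We[c ->] <-]; exists c.
by rewrite mulr_sumr; apply: eq_bigr => i _; rewrite scalerAr.
Qed.

(** The shift of [A * C] has one term in [A * W] and a multiple of the shift of [A], which [U]
    absorbs because it contains [A]. *)
Lemma shift_stableM A U W : shift_stable U -> shift_stable W -> U A ->
  shift_stable (sum_subspace U ( *%R A @` W)).
Proof.
move=> [sU stU] [sW stW] UA; split=> [|x _ [B UB [_ [C WC <-] <-]]].
  by apply: subspace_sum_subspace; last exact: subspace_mull.
rewrite linearD /= shiftM; exists (eps C *: shift [:: x] A + shift [:: x] B).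
  by apply: sU.2; exact: stU.
exists (A * shift [:: x] C); last by rewrite -addrA addrC addrA.
by exists (shift [:: x] C); first exact: stW.
Qed.

(** By the two rules, both terms of the shift of [A^-1 * B] have the left factor [A^-1]; the other
    factors combine to the shift of [B] minus a multiple of the shift of [A], both in [W]. *)
Lemma shift_stableV A W : A \is a GRing.unit -> shift_stable W -> W A ->
  shift_stable ( *%R A^-1 @` W).
Proof.
move=> uA [sW stW] WA; split=> [|x _ [B WB <-]]; first exact: subspace_mull.
exists (shift [:: x] B - (eps B * eps A^-1) *: shift [:: x] A).
  by apply: subspaceB => //; [|apply: subspaceZ => //]; apply: stW.
by rewrite shiftM shiftV // mulrBr scalerN -scalerAr scalerA.
Qed.

End ShiftStable.

(** * Finite dimension of the closure of a rational series *)

Section RationalClosure.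
Variables (K : fieldType) (X : finType).
Implicit Types (A B : series K X) (W : set (series K X)).

Definition recognizable A : Prop :=
  exists2 W, shift_stable W & W A /\ exists n, spanned_by n W.

(** A shift by one letter sends the series [x] to 1 or 0, so the span of [x] and 1 is stable. *)
Lemma recognizable_letter (x : X) : recognizable (letter K x).
Proof.
have s1 := shift_stable_constants K X.
pose L := fspan (fun _ : 'I_1 => letter K x).
have sL : subspace L by exact: subspace_fspan.
exists (sum_subspace L constants).
  split=> [|y _ [_ [c ->] [B cB <-]]].
    by apply: subspace_sum_subspace => //; case: s1.
  rewrite linearD /= big_ord1 linearZ /=.
  have -> : shift [:: y] (letter K x) = (y == x)%:R *: 1.
    apply/funext => w; rewrite /shift /letter.
    rewrite -[RHS]/((y == x)%:R * (w == [::])%:R).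
    by case: w => [|z [|z' w]]; rewrite /= ?mulr0 ?mulr1 ?eqseq_cons ?andbT ?andbF.
  apply: sum_subspacer => //; apply: subspaceD; [by case: s1| |exact: s1.2].
  by rewrite scalerA; eexists.
split; first by apply: sum_subspacel; [case: s1|exact: (fspan_mem _ ord0)].
exists (1 + 1)%N; apply: spanned_byD; last exact: constants_spanned_by1.
by exists (fun=> letter K x).
Qed.

(** With stable spaces [U] for [A] and [W] for [B], linear combinations lie in [U + W] and the
    product in [U + A W]. For the inverse of [A] in [W], the space is [A^-1 (W + K)]. *)
Lemma recognizable_closed :
  rationally_closed (fun A => `[< recognizable A >] : bool).
Proof.
have s1 := shift_stable_constants K X.
split; [split|].
- apply/asboolP; exists constants => //; split; first exact: constants1.
  by exists 1%N; exact: constants_spanned_by1.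
- move=> a A B /asboolP[U sU [UA [m gU]]] /asboolP[W sW [WB [n gW]]].
  apply/asboolP; exists (sum_subspace U W); first exact: shift_stableD.
  split; last by exists (m + n)%N; exact: spanned_byD.
  by exists (a *: A); [exact: subspaceZ sU.1 UA|exists B].
- move=> A B /asboolP[U sU [UA [m gU]]] /asboolP[W sW [WB [n gW]]].
  apply/asboolP; exists (sum_subspace U ( *%R A @` W)); first exact: shift_stableM.
  split; first by apply: sum_subspacer; [exact: sU.1|exists B].
  by exists (m + n)%N; apply: spanned_byD => //; exact: spanned_by_mull.
- move=> A /asboolP[W sW [WA [n gW]]] uA; apply/asboolP.
  (* Constants are adjoined so that [A^-1 = A^-1 * 1] lies in the image. *)
  pose W1 := sum_subspace W constants.
  exists ( *%R A^-1 @` W1).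
    apply: shift_stableV => //; first exact: shift_stableD.
    by apply: sum_subspacel => //; exact: s1.1.
  split.
    exists 1; last by rewrite mulr1.
    by apply: sum_subspacer; [exact: sW.1|exact: constants1].
  exists (n + 1)%N; apply: spanned_by_mull; apply: spanned_byD => //.
  exact: constants_spanned_by1.
Qed.

(** One direction of Schützenberger's theorem, from the minimality of the rational series. *)
Lemma rational_recognizable A : A \in @Defs.rational K X -> recognizable A.
Proof.
move=> /asboolP/(_ _ recognizable_closed) rA; apply/asboolP; apply: rA => x.
exact/asboolP/recognizable_letter.
Qed.

Definition unital_closure A : set (series K X) :=
  sum_subspace (rec_closure A) constants.

Lemma shift_stable_unital_closure A : shift_stable (unital_closure A).
Proof.
by apply: shift_stableD; [exact: shift_stable_rec_closure|exact: shift_stable_constants].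
Qed.

Lemma unital_closure_mem A : unital_closure A A.
Proof.
apply: sum_subspacel; first by case: (shift_stable_constants K X).
exact: rec_closure_mem.
Qed.

Lemma unital_closure1 A : unital_closure A 1.
Proof. by apply: sum_subspacer; [exact: subspace_lspan|exact: constants1]. Qed.

(** The source of all upper bounds on the dimension: it is enough to exhibit a small stable space
    containing [A] and 1. *)
Lemma unital_closure_min A W :
  shift_stable W -> W A -> W 1 -> unital_closure A `<=` W.
Proof.
move=> sW WA W1; apply: sum_subspace_min; first exact: sW.1.
  exact: rec_closure_min.
exact: constants_min sW.1 W1.
Qed.

Lemma unital_closure_finite_dim A :
  A \in @Defs.rational K X -> finite_dim (unital_closure A).
Proof.
move=> /rational_recognizable[W sW [WA [n gW]]].
apply: (@spanned_by_finite_dim _ _ (n + 1)).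
  by case: (shift_stable_unital_closure A).
have [e We] := spanned_byD gW (constants_spanned_by1 K X); exists e.
apply: subset_trans We; apply: unital_closure_min.
- by apply: shift_stableD => //; exact: shift_stable_constants.
- by apply: sum_subspacel => //; case: (shift_stable_constants K X).
- by apply: sum_subspacer; [exact: sW.1|exact: constants1].
Qed.

End RationalClosure.

(** * The norm axioms, as statements on dimensions *)

Section Norm.
Variables (K : fieldType) (X : finType).
Implicit Types (A B : srat K X).

Definition closure_dim A : nat := subspace_dim (unital_closure A).

Lemma srat_eps A : eps A = 1.
Proof. by case/andP: (srat_valP A) => _ /eqP. Qed.

Lemma srat_finite_dim A : finite_dim (unital_closure A).
Proof. by apply: unital_closure_finite_dim; case/andP: (srat_valP A). Qed.

Lemma srat_neq0 A : (A : series K X) <> 0.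
Proof.
move=> A0; have := srat_unit A; rewrite unit_seriesE A0.
by rewrite /eps -[X in X != _]/(0 : K) eqxx.
Qed.

(** The series 1 alone is a free family in the closure. *)
Lemma closure_dim_gt0 A : (0 < closure_dim A)%N.
Proof.
apply: (free_leq_dim (e := fcons 1 (fun _ : 'I_0 => 0)) (srat_finite_dim A)).
  by apply: free_fcons0; apply/eqP; exact: oner_neq0.
by move=> i; rewrite /fcons; case: unlift => [[]|] //; exact: unital_closure1.
Qed.

Lemma closure_dim1 : closure_dim (1%g : srat K X) = 1%N.
Proof.
apply/eqP; rewrite eqn_leq closure_dim_gt0 andbT; apply: subspace_dim_leq.
  by case: (shift_stable_unital_closure (1 : series K X)).
have [e Ke] := constants_spanned_by1 K X; exists e; apply: subset_trans Ke.
apply: unital_closure_min; [exact: shift_stable_constants| |]; exact: constants1.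
Qed.

(** The series 1 and [A] are independent: they agree on the empty word, so they differ on a nonempty
    one, where 1 vanishes and [A] does not. *)
Lemma closure_dim_gt1 A : A <> 1%g -> (1 < closure_dim A)%N.
Proof.
move=> A1; have [w Aw] : exists w, (A : series K X) w <> (1 : series K X) w.
  apply: contrapT => NA; apply: A1; apply: val_inj; apply/funext => w.
  by apply: contrapT => Aw; apply: NA; exists w.
case: w Aw => [|x w] Aw; first by case: Aw; exact: srat_eps.
apply: (free_leq_dim (e := fcons 1 (fcons (A : series K X) (fun _ : 'I_0 => 0)))
          (srat_finite_dim A)).
  move=> c; rewrite sum_fcons sum_fcons big_ord0 addr0.
  set a := c ord0; set b := c (lift ord0 ord0) => ab.
  have b0 : b = 0.
    (* Reading the relation at [x :: w] isolates the coefficient of [A]. *)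
    move/(congr1 (fun B : series K X => B (x :: w))): ab => /eqP.
    rewrite -[X in X == _]/(a * 0 + b * (A : series K X) (x :: w)).
    by rewrite mulr0 add0r -[X in _ == X]/(0 : K) mulf_eq0 => /orP[/eqP|/eqP].
  have a0 : a = 0.
    move/eqP: ab; rewrite b0 scale0r addr0 scaler_eq0 oner_eq0 orbF.
    by move/eqP.
  by move=> i; case: (unliftP ord0 i) => [j ->|->] //; rewrite ord1.
move=> i; rewrite /fcons; case: unlift => [j|] /=; last exact: unital_closure1.
by case: unlift => [[]|] //=; exact: unital_closure_mem.
Qed.

(** Strictness comes from the nonzero vector [A = A * 1] shared by the closure of [A] and [A] times
    the closure of [B]. It pays for the extra 1 in the triangle inequality. *)
Lemma closure_dimM A B : (closure_dim (A * B)%g < closure_dim A + closure_dim B)%N.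
Proof.
have sA := shift_stable_unital_closure A; have sB := shift_stable_unital_closure B.
pose AB := *%R (A : series K X) @` unital_closure B.
have sAB : subspace AB by apply: subspace_mull; exact: sB.1.
have gAB := spanned_by_mull A (spanned_by_dim (srat_finite_dim B)).
have AB_A : AB (A : series K X) by exists 1; [exact: unital_closure1|rewrite mulr1].
have [n ltn [e eP]] := sum_subspace_dim_ltn (srat_finite_dim A)
  (spanned_by_finite_dim sAB gAB) sA.1 (unital_closure_mem A) AB_A (@srat_neq0 A).
apply: leq_trans (leq_trans ltn _); last first.
  by rewrite leq_add2l; exact: subspace_dim_leq.
rewrite ltnS; apply: subspace_dim_leq.
  by case: (shift_stable_unital_closure (A * B)%g).
exists e; apply: subset_trans eP; apply: unital_closure_min.
- by apply: shift_stableM => //; exact: unital_closure_mem.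
- by apply: sum_subspacer; [exact: sA.1|exists B => //; exact: unital_closure_mem].
- by apply: sum_subspacel => //; exact: unital_closure1.
Qed.

Lemma closure_dimV_leq A : (closure_dim A^-1%g <= closure_dim A)%N.
Proof.
have sA := shift_stable_unital_closure A.
apply: subspace_dim_leq.
  by case: (shift_stable_unital_closure (A^-1)%g).
have [e eP] := spanned_by_mull (A : series K X)^-1 (spanned_by_dim (srat_finite_dim A)).
exists e; apply: subset_trans eP; apply: unital_closure_min.
- by apply: shift_stableV => //; [exact: srat_unit|exact: unital_closure_mem].
- by exists 1; [exact: unital_closure1|rewrite mulr1].
- by exists (A : series K X); [exact: unital_closure_mem|rewrite mulVr ?srat_unit].
Qed.

(** The inequality for [A] and for [A^-1], inversion being an involution. *)
Lemma closure_dimV A : closure_dim A^-1%g = closure_dim A.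
Proof.
apply/eqP; rewrite eqn_leq closure_dimV_leq /=.
by rewrite -{1}[A]invgK closure_dimV_leq.
Qed.

End Norm.

(** Finite dimension is asserted as well, since [subspace_dim] defaults to 0 where no finite basis
    exists; it ensures that the norm is read off a genuine dimension. *)
Theorem theorem8p1 (R : realType) (K : fieldType) (X : finType) :
  (forall A : srat K X, finite_dim (sum_subspace (rec_closure A) constants)) /\
  is_group_norm (fun A : srat K X => rat_norm R A).
Proof.
split; first exact: srat_finite_dim.
have normE (A : srat K X) : rat_norm R A = (closure_dim A)%:R - 1 by [].
split=> [A||A A1|A B|A]; rewrite !normE.
- by rewrite subr_ge0 ler1n closure_dim_gt0.
- by rewrite closure_dim1 subrr.
- by rewrite subr_gt0 ltr1n closure_dim_gt1.
(* One unit is subtracted on the left and two on the right, so the claim is the strict inequality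
   between natural numbers. *)
- rewrite addrA lerBlDr subrK addrAC lerBrDr natr1 -natrD ler_nat.
  exact: closure_dimM.
- by rewrite closure_dimV.
Qed.
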